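(* Consider the single stage pricing game with additive loyalty described in the context, with parameters $c_A\ge c_B\ge 0$, $s_\alpha,s_\beta\ge0$, $\theta\in(0,1)$, and $F$ the distribution function of the uniform distribution on $[0,1]$. Suppose (Region IV) $$c_A-c_B\le\min(s_\alpha-1,\;1-s_\beta) .$$ Then the game has a unique pure Nash equilibrium, and its prices are $$p_A^\alpha=c_B+s_\alpha,\quad p_A^\beta=\tfrac13(c_B+2c_A-s_\beta+1),\quad p_B^\beta=\tfrac13(2c_B+c_A+s_\beta+2),\quad p_B^\alpha=c_B .$$
   Context: Two firms $A$ and $B$ sell the same product, with unit product costs $c_A$ and $c_B$, where $c_A\ge c_B\ge 0$. Customers are partitioned into a set $\alpha$ (ex ante loyal to $A$; a fraction $\theta$ of the market) and a set $\beta$ (ex ante loyal to $B$; a fraction $1-\theta$). Both firms can tell the two sets apart. Each customer buys exactly one unit, from $A$ or from $B$. Firms move simultaneously: $A$ chooses $(p_A^\alpha,p_A^\beta)$ with $p_A^\alpha,p_A^\beta\ge c_A$, and $B$ chooses $(p_B^\beta,p_B^\alpha)$ with $p_B^\beta,p_B^\alpha\ge c_B$; the superscript is the set of customers to which the price is offered. Additive loyalty: a customer in $\alpha$ has loyalty level $\xi+s_\alpha$ and buys from $A$ iff $\xi+s_\alpha\ge p_A^\alpha-p_B^\alpha$; a customer in $\beta$ has loyalty level $\xi+s_\beta$ and buys from $B$ iff $\xi+s_\beta\ge p_B^\beta-p_A^\beta$; here $\xi$ is random with distribution function $F$. Put $\xi^\alpha=p_A^\alpha-p_B^\alpha-s_\alpha$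 and $\xi^\beta=p_B^\beta-p_A^\beta-s_\beta$. For the uniform distribution, $F(x)=0$ for $x\le 0$, $F(x)=x$ for $0\le x\le1$, $F(x)=1$ for $x\ge1$. Profits: firm $A$ gets $(p_A^\alpha-c_A)\,\theta\,(1-F(\xi^\alpha))+(p_A^\beta-c_A)(1-\theta)F(\xi^\beta)$; firm $B$ gets $(p_B^\beta-c_B)(1-\theta)(1-F(\xi^\beta))+(p_B^\alpha-c_B)\,\theta\,F(\xi^\alpha)$. A pure Nash equilibrium is a price profile $(p_A^\alpha,p_A^\beta,p_B^\beta,p_B^\alpha)$ from which neither firm can strictly increase its profit by unilaterally changing its own (feasible) prices. *)

(* Defs.v *)
From Stdlib Require Import Reals.
Open Scope R_scope.

Set Implicit Arguments.

(* [theta] is the market fraction of the customers ex ante loyal to A (the set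
   alpha); [F] is the distribution function of the random loyalty shift xi. *)
Record game := Game {
  cA : R;
  cB : R;
  s_alpha : R;
  s_beta : R;
  theta : R;
  F : R -> R
}.

(* A strategy of either firm is the pair of prices it offers to the customers
   in alpha and in beta, in this order for both firms. *)
Record strategy := Strategy {
  p_alpha : R;
  p_beta : R
}.

Record profile := Profile {
  stratA : strategy;
  stratB : strategy
}.

Definition feasible (c : R) (p : strategy) : Prop :=
  c <= p_alpha p /\ c <= p_beta p.

Definition xi_alpha (g : game) (a b : strategy) : R :=
  p_alpha a - p_alpha b - s_alpha g.

Definition xi_beta (g : game) (a b : strategy) : R :=
  p_beta b - p_beta a - s_beta g.

(* A customer in alpha buys from A iff xi >= xi_alpha, and a customer in beta
   buys from B iff xi >= xi_beta; with F continuous, A thus keeps the share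
   1 - F xi_alpha of alpha and attracts the share F xi_beta of beta. *)
Definition profitA (g : game) (a b : strategy) : R :=
  (p_alpha a - cA g) * theta g * (1 - F g (xi_alpha g a b)) +
  (p_beta a - cA g) * (1 - theta g) * F g (xi_beta g a b).

Definition profitB (g : game) (a b : strategy) : R :=
  (p_beta b - cB g) * (1 - theta g) * (1 - F g (xi_beta g a b)) +
  (p_alpha b - cB g) * theta g * F g (xi_alpha g a b).

Definition pure_nash (g : game) (p : profile) : Prop :=
  feasible (cA g) (stratA p) /\
  feasible (cB g) (stratB p) /\
  (forall a, feasible (cA g) a ->
     profitA g a (stratB p) <= profitA g (stratA p) (stratB p)) /\
  (forall b, feasible (cB g) b ->
     profitB g (stratA p) b <= profitB g (stratA p) (stratB p)).

Definition uniform_cdf (x : R) : R :=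
  if Rle_dec x 0 then 0 else if Rle_dec x 1 then x else 1.

(* Main.v *)
(** The profits split into one summand per customer set, and each price enters
    only one of them, so the game is a product of two independent single-price
    duopolies, one for alpha (incumbent A) and one for beta (incumbent B). With
    [z] the marginal loyalty shift, the incumbent's margin is [1 - z] and the
    rival's is [z] at an interior equilibrium. In alpha the loyalty is so strong
    that the incumbent prefers to keep every customer, which pins the rival at
    cost and [z] at [0]; in beta the first-order conditions determine [z]. *)
Require Import Defs.
From Stdlib Require Import Reals Lra.
Open Scope R_scope.

(** Incumbent with cost [c] and price [x], rival with cost [k] and price [y]. The market fraction is
    dropped: a positive factor does not affect best replies. *)
Definition duopoly_nash (c k s x y : R) : Prop :=
  c <= x /\ k <= y /\
  (forall x', c <= x' ->
     (x' - c) * (1 - uniform_cdf (x' - y - s)) <=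
     (x - c) * (1 - uniform_cdf (x - y - s))) /\
  (forall y', k <= y' ->
     (y' - k) * uniform_cdf (x - y' - s) <=
     (y - k) * uniform_cdf (x - y - s)).

Lemma uniform_cdf_nonpos (z : R) : z <= 0 -> uniform_cdf z = 0.
Proof. intros h; unfold uniform_cdf; destruct (Rle_dec z 0); lra. Qed.

Lemma uniform_cdf_mid (z : R) : 0 <= z <= 1 -> uniform_cdf z = z.
Proof.
intros h; unfold uniform_cdf.
destruct (Rle_dec z 0); destruct (Rle_dec z 1); lra.
Qed.

Lemma uniform_cdf_ge1 (z : R) : 1 <= z -> uniform_cdf z = 1.
Proof.
intros h; unfold uniform_cdf.
destruct (Rle_dec z 0); destruct (Rle_dec z 1); lra.
Qed.

(** Changing one price at a time isolates one summand, whose positive weight cancels; conversely the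
    weighted inequalities add up. *)
Lemma pure_nash_duopolies (cA cB sa sb theta : R) (a b : strategy) :
  0 < theta < 1 ->
  pure_nash (Game cA cB sa sb theta uniform_cdf) (Profile a b) <->
  duopoly_nash cA cB sa (p_alpha a) (p_alpha b) /\
  duopoly_nash cB cA sb (p_beta b) (p_beta a).
Proof.
intros ht; destruct a as [aa ab], b as [ba bb].
unfold pure_nash, duopoly_nash, feasible, profitA, profitB, xi_alpha, xi_beta;
  simpl.
split.
- intros [[h1 h2] [[h3 h4] [hA hB]]].
  repeat split; try assumption.
  + intros x hx; specialize (hA (Strategy x ab) (conj hx h2)); simpl in hA.
    apply Rmult_le_reg_l with theta; lra.
  + intros x hx; specialize (hB (Strategy x bb) (conj hx h4)); simpl in hB.
    apply Rmult_le_reg_l with theta; lra.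
  + intros x hx; specialize (hB (Strategy ba x) (conj h3 hx)); simpl in hB.
    apply Rmult_le_reg_l with (1 - theta); lra.
  + intros x hx; specialize (hA (Strategy aa x) (conj h1 hx)); simpl in hA.
    apply Rmult_le_reg_l with (1 - theta); lra.
- intros [[h1 [h3 [hAa hBa]]] [h4 [h2 [hBb hAb]]]].
  repeat split; try assumption; intros [x y] [hx hy]; simpl in *.
  + generalize (Rmult_le_compat_l theta _ _ ltac:(lra) (hAa x hx)).
    generalize (Rmult_le_compat_l (1 - theta) _ _ ltac:(lra) (hAb y hy)).
    lra.
  + generalize (Rmult_le_compat_l theta _ _ ltac:(lra) (hBa x hx)).
    generalize (Rmult_le_compat_l (1 - theta) _ _ ltac:(lra) (hBb y hy)).
    lra.
Qed.

(** On the linear part of the cdf, shifting a price by [t] changes its owner's profit by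
    [t * a - t * t], with [a] the marginal profit. The maximizer [a / 2], or the endpoint if that is
    out of range, gives a strict gain unless [a = 0]. *)
Lemma first_order_condition (a d : R) :
  0 < d -> (forall t, - d <= t <= d -> t * a <= t * t) -> a = 0.
Proof.
intros hd H.
destruct (Rtotal_order a 0) as [ha | [ha | ha]]; [| exact ha |]; exfalso.
- destruct (Rle_dec d (- a / 2)).
  + specialize (H (- d) ltac:(lra)); nra.
  + specialize (H (a / 2) ltac:(lra)); nra.
- destruct (Rle_dec d (a / 2)).
  + specialize (H d ltac:(lra)); nra.
  + specialize (H (a / 2) ltac:(lra)); nra.
Qed.

(* If [z < 0] the incumbent can raise its price without losing a customer, and
   at [z = 0] a rival with a positive margin gains by undercutting. *)
Lemma nash_full_retention (c k s x y : R) :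
  duopoly_nash c k s x y -> x - y - s <= 0 -> x = y + s /\ y = k.
Proof.
intros [hx [hy [H1 H2]]] hz.
assert (hxy : x = y + s).
{ destruct (Rle_lt_or_eq_dec _ _ hz) as [h | h]; [exfalso | lra].
  specialize (H1 (y + s) ltac:(lra)).
  rewrite !uniform_cdf_nonpos in H1; lra. }
split; [exact hxy |].
destruct (Rle_lt_or_eq_dec _ _ hy) as [h | h]; [exfalso | lra].
(* Undercutting by [e] wins the share [e], as [e <= 1], and leaves at least half the margin. *)
pose (e := Rmin 1 ((y - k) / 2)).
assert (he : 0 < e <= 1 /\ e <= (y - k) / 2).
{ unfold e; repeat split.
  - apply Rmin_glb_lt; lra.
  - apply Rmin_l.
  - apply Rmin_r. }
specialize (H2 (y - e) ltac:(lra)).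
rewrite (uniform_cdf_nonpos (x - y - s)), (uniform_cdf_mid (x - (y - e) - s))
  in H2 by lra.
subst x; nra.
Qed.

(** At price [y + s] the incumbent keeps everyone with a margin [M >= 1]. Raising it by [z > 0]
    yields [(M + z) * (1 - z) < M] for [z <= 1] and nothing beyond. *)
Lemma duopoly_nash_strong_loyalty (c k s x y : R) :
  c + 1 <= k + s -> duopoly_nash c k s x y <-> x = k + s /\ y = k.
Proof.
intros hs; split.
- intros H.
  destruct (Rle_lt_dec (x - y - s) 0) as [hz | hz].
  { destruct (nash_full_retention _ _ _ _ _ H hz); lra. }
  exfalso.
  destruct H as [hx [hy [H1 _]]].
  specialize (H1 (y + s) ltac:(lra)).
  rewrite (uniform_cdf_nonpos (y + s - y - s)) in H1 by lra.
  destruct (Rle_lt_dec (x - y - s) 1).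
  + rewrite uniform_cdf_mid in H1 by lra; nra.
  + rewrite uniform_cdf_ge1 in H1 by lra; nra.
- intros [-> ->].
  repeat split; try lra.
  + intros x' hx'; rewrite (uniform_cdf_nonpos (k + s - k - s)) by lra.
    destruct (Rle_lt_dec (x' - k - s) 0).
    { rewrite uniform_cdf_nonpos by lra; lra. }
    destruct (Rle_lt_dec (x' - k - s) 1).
    * rewrite uniform_cdf_mid by lra; nra.
    * rewrite uniform_cdf_ge1 by lra; nra.
  + intros y' hy'; rewrite !uniform_cdf_nonpos by lra; lra.
Qed.

Lemma nash_interior (c k s x y : R) :
  duopoly_nash c k s x y -> 0 < x - y - s < 1 ->
  x - c = 1 - (x - y - s) /\ y - k = x - y - s.
Proof.
intros [hx [hy [H1 H2]]].
set (z := x - y - s) in *; intros hz.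
rewrite (uniform_cdf_mid z) in H1, H2 by lra.
assert (D1 : forall t, c <= x + t -> 0 <= z + t <= 1 ->
          (x + t - c) * (1 - (z + t)) <= (x - c) * (1 - z)).
{ intros t h1 h2; specialize (H1 (x + t) h1).
  replace (x + t - y - s) with (z + t) in H1 by (unfold z; ring).
  rewrite uniform_cdf_mid in H1 by lra; exact H1. }
assert (D2 : forall t, k <= y + t -> 0 <= z - t <= 1 ->
          (y + t - k) * (z - t) <= (y - k) * z).
{ intros t h1 h2; specialize (H2 (y + t) h1).
  replace (x - (y + t) - s) with (z - t) in H2 by (unfold z; ring).
  rewrite uniform_cdf_mid in H2 by lra; exact H2. }
clearbody z.
(* Both prices lie strictly above cost, since a zero margin is beaten by a small increase that keeps
   half the share. Shifts in both directions are then feasible. *)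
assert (hx' : c < x).
{ destruct (Rle_lt_or_eq_dec _ _ hx) as [h | h]; [exact h | exfalso].
  specialize (D1 ((1 - z) / 2) ltac:(lra) ltac:(lra)); nra. }
assert (hy' : k < y).
{ destruct (Rle_lt_or_eq_dec _ _ hy) as [h | h]; [exact h | exfalso].
  specialize (D2 (z / 2) ltac:(lra) ltac:(lra)); nra. }
pose (d := Rmin (Rmin (x - c) (y - k)) (Rmin z (1 - z))).
assert (hd : 0 < d) by (unfold d; repeat apply Rmin_glb_lt; lra).
assert (hd1 : d <= x - c /\ d <= y - k /\ d <= z /\ d <= 1 - z).
{ generalize (Rmin_l (x - c) (y - k)) (Rmin_r (x - c) (y - k))
    (Rmin_l z (1 - z)) (Rmin_r z (1 - z))
    (Rmin_l (Rmin (x - c) (y - k)) (Rmin z (1 - z)))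
    (Rmin_r (Rmin (x - c) (y - k)) (Rmin z (1 - z))).
  fold d; lra. }
clearbody d.
split.
- enough (1 - z - (x - c) = 0) by lra.
  apply first_order_condition with d; [exact hd |].
  intros t ht; specialize (D1 t ltac:(lra) ltac:(lra)); lra.
- enough (z - (y - k) = 0) by lra.
  apply first_order_condition with d; [exact hd |].
  intros t ht; specialize (D2 t ltac:(lra) ltac:(lra)); lra.
Qed.

(** The margins [1 - z] and [z] force [z = (c + 1 - k - s) / 3], which the hypothesis places in
    [[0, 1)]. *)
Lemma duopoly_nash_weak_loyalty (c k s x y : R) :
  c - 1 < k + s <= c + 1 ->
  duopoly_nash c k s x y <->
  x = 1 / 3 * (2 * c + k + s + 2) /\ y = 1 / 3 * (c + 2 * k - s + 1).
Proof.
intros hs; split.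
- intros H.
  destruct (Rle_lt_dec (x - y - s) 0) as [hz | hz].
  { (* Raising the price is unprofitable only if the margin is at least 1, so
       this case is the boundary [k + s = c + 1]. *)
    destruct (nash_full_retention _ _ _ _ _ H hz) as [hx hy].
    destruct H as [hcx [_ [H1 _]]]; subst x y.
    enough (1 <= k + s - c) by lra.
    destruct (Rle_lt_dec 1 (k + s - c)) as [h | h]; [exact h | exfalso].
    (* With margin [M = k + s - c], this increase maximizes the gain [t * (1 - M) - t * t]. *)
    specialize (H1 (k + s + (1 - (k + s - c)) / 2) ltac:(lra)).
    rewrite (uniform_cdf_nonpos (k + s - k - s)), uniform_cdf_mid in H1 by lra.
    nra. }
  destruct (Rlt_le_dec (x - y - s) 1) as [hz' | hz'].
  { destruct (nash_interior _ _ _ _ _ H ltac:(lra)); lra. }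
  exfalso.
  destruct H as [hx [hy [H1 _]]].
  rewrite (uniform_cdf_ge1 (x - y - s)) in H1 by lra.
  (* The incumbent sells nothing here. Pricing at [y + s + 1 - e] regains the share [e] with margin
     at least [e], because [y >= k]. *)
  pose (e := (1 + k + s - c) / 2).
  specialize (H1 (y + s + 1 - e) ltac:(unfold e; lra)).
  rewrite uniform_cdf_mid in H1 by (unfold e; lra).
  assert (0 < e) by (unfold e; lra).
  assert (0 < y + s + 1 - e - c) by (unfold e; lra).
  nra.
- intros [hx hy].
  (* [m] is the equilibrium value of [x - y - s]; the profits become [(1 - m)^2] and [m^2]. *)
  pose (m := (c + 1 - k - s) / 3).
  assert (hm : 0 <= m < 1) by (unfold m; lra).
  assert (ex : x = c + (1 - m)) by (unfold m; lra).
  assert (ey : y = k + m) by (unfold m; lra).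
  assert (es : s = c + 1 - k - 3 * m) by (unfold m; lra).
  clearbody m; clear hx hy; subst x y s.
  unfold duopoly_nash; rewrite uniform_cdf_mid by lra.
  repeat split; try lra.
  + intros x' hx'.
    destruct (Rle_lt_dec (x' - (k + m) - (c + 1 - k - 3 * m)) 0).
    { rewrite uniform_cdf_nonpos by lra; nra. }
    destruct (Rle_lt_dec (x' - (k + m) - (c + 1 - k - 3 * m)) 1).
    * rewrite uniform_cdf_mid by lra.
      (* The loss from deviating is exactly the square of the price change. *)
      generalize (Rle_0_sqr (x' - (c + (1 - m)))); unfold Rsqr; lra.
    * rewrite uniform_cdf_ge1 by lra; nra.
  + intros y' hy'.
    destruct (Rle_lt_dec (c + (1 - m) - y' - (c + 1 - k - 3 * m)) 0).
    { rewrite uniform_cdf_nonpos by lra; nra. }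
    destruct (Rle_lt_dec (c + (1 - m) - y' - (c + 1 - k - 3 * m)) 1).
    * rewrite uniform_cdf_mid by lra.
      generalize (Rle_0_sqr (y' - (k + m))); unfold Rsqr; lra.
    * rewrite uniform_cdf_ge1 by lra; nra.
Qed.

Theorem proposition18 (cA cB s_alpha s_beta theta : R)
  (hc : cA >= cB) (hcB : cB >= 0)
  (hs_alpha : 0 <= s_alpha) (hs_beta : 0 <= s_beta)
  (htheta : 0 < theta < 1)
  (regionIV : cA - cB <= Rmin (s_alpha - 1) (1 - s_beta)) :
  unique (pure_nash (Game cA cB s_alpha s_beta theta uniform_cdf))
    (Profile
       (Strategy (cB + s_alpha) (1 / 3 * (cB + 2 * cA - s_beta + 1)))
       (Strategy cB (1 / 3 * (2 * cB + cA + s_beta + 2)))).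
Proof.
(* The two bounds give strong loyalty in alpha and [cA + s_beta <= cB + 1] in beta; there the strict
   lower bound follows from [cA >= cB] and [s_beta >= 0]. *)
generalize (Rmin_l (s_alpha - 1) (1 - s_beta))
  (Rmin_r (s_alpha - 1) (1 - s_beta)); intros hl hr.
split.
- apply pure_nash_duopolies; [exact htheta |]; simpl.
  rewrite duopoly_nash_strong_loyalty, duopoly_nash_weak_loyalty by lra.
  repeat split; reflexivity.
- intros [[aa ab] [ba bb]] H.
  apply pure_nash_duopolies in H; [simpl in H | exact htheta].
  rewrite duopoly_nash_strong_loyalty, duopoly_nash_weak_loyalty in H by lra.
  destruct H as [[-> ->] [-> ->]]; reflexivity.
Qed.
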